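(* Let $n\ge1$ and let $K_{2n+1}^{(3)}$ be the complete 3-graph on vertex set $[2n+1]$ (all 3-subsets are triples), with the canonical triple orientation $\omega_0$. Let $\mathcal T^+$ and $\mathcal T^-$ be the sets of spanning trees $T$ of $K_{2n+1}^{(3)}$ with $\mathrm{sgn}(T,\omega_0)=+1$ and $-1$ respectively. Then $|\mathcal T^+|-|\mathcal T^-|=(2n+1)^{n-1}$.
   Context: A cycle in a 3-graph is a sequence $a_0,t_1,a_1,\dots,t_\ell,a_\ell=a_0$, $\ell\ge2$, of distinct vertices $a_0,\dots,a_{\ell-1}$ and distinct triples with $a_{i-1},a_i\in t_i$. A spanning tree is a set of triples containing no cycle, covering all vertices, and connected via paths of triples. A triple orientation $\omega$ on vertex set $[2n+1]$ assigns each triple $t=\{i,j,k\}$ a 3-cycle $\sigma(t,\omega)\in\{(i\,j\,k),(j\,i\,k)\}$; the canonical orientation $\omega_0$ assigns to $\{i,j,k\}$ with $i<j<k$ the cycle $(i\,j\,k)$. For a spanning tree $T$, $\prod_{t\in T}\sigma(t,\omega)$ is a $(2n+1)$-cycle $(s(1)\,s(2)\cdots s(2n+1))$ for some permutation $s$ of $[2n+1]$, and $\mathrm{sgn}(T,\omega)$ is the sign of $s$ (independent of the order of factors and of how the cycle is written). *)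

(* Defs.v *)
From mathcomp Require Import all_boot all_algebra all_fingroup.

Set Implicit Arguments.
Unset Strict Implicit.
Unset Printing Implicit Defensive.

Section ThreeGraphs.
Variable V : finType.
Implicit Types H T : {set {set V}}.

Definition complete3 : {set {set V}} := [set t : {set V} | #|t| == 3].

(* [a] lists a_0, ..., a_{l-1} and [ts] lists t_1, ..., t_l; as [rot 1 a] lists
   a_1, ..., a_{l-1}, a_0, the last conjunct says that a_{i-1} and a_i belong
   to t_i for all i (and that [a] and [ts] have the same length). *)
Definition is_cycle3 T (a : seq V) (ts : seq {set V}) : bool :=
  [&& 2 <= size a, uniq a, uniq ts, all [in T] ts
    & all2 (fun e (t : {set V}) => (e.1 \in t) && (e.2 \in t))
           (zip a (rot 1 a)) ts].

(* The bound on the length is harmless since the vertices of a cycle are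
   distinct: see [has_cycle3P]. *)
Definition has_cycle3 T : bool :=
  [exists l : 'I_#|V|.+1, exists a : l.-tuple V, exists ts : l.-tuple {set V},
    is_cycle3 T a ts].

Lemma has_cycle3P T :
  reflect (exists a ts, is_cycle3 T a ts) (has_cycle3 T).
Proof.
apply: (iffP existsP) => [[l /existsP[a /existsP[ts Hc]]] | [a [ts Hc]]].
  by exists a, ts.
have /and5P[_ ua _ _] := Hc; rewrite all2E => /andP[/eqP szt _].
have la : size a < #|V|.+1 by rewrite ltnS -(card_uniqP ua) max_card.
have sz : size ts == size a by rewrite -szt size_zip size_rot minnn.
exists (Ordinal la); apply/existsP; exists (in_tuple a).
by apply/existsP; exists (Tuple sz).
Qed.

Definition adjacent3 T : rel V :=
  fun x y => [exists t in T, (x \in t) && (y \in t)].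

Definition spanning_tree3 H T : bool :=
  [&& T \subset H, ~~ has_cycle3 T, cover T == [set: V]
    & [forall x, forall y, connect (adjacent3 T) x y]].

End ThreeGraphs.

Arguments complete3 V : clear implicits.

Section TripleOrientations.
Variable N : nat.
Implicit Types (i j k : 'I_N) (t : {set 'I_N}) (T : {set {set 'I_N}}).
Implicit Types (p s : {perm 'I_N}) (w : {set 'I_N} -> {perm 'I_N}).

(* The 3-cycle i -> j -> k -> i; permutations are composed from left to
   right. *)
Definition cycle3 i j k : {perm 'I_N} := (tperm i j * tperm i k)%g.

Lemma cycle3E i j k : uniq [:: i; j; k] ->
  [/\ cycle3 i j k i = j, cycle3 i j k j = k, cycle3 i j k k = i
    & forall x, x \notin [:: i; j; k] -> cycle3 i j k x = x].
Proof.
rewrite /= !inE negb_or andbT => /andP[/andP[ij ik] jk].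
split=> [|||x].
- by rewrite permM tpermL tpermD // eq_sym.
- by rewrite permM tpermR tpermL.
- by rewrite permM (tpermD ik jk) tpermR.
rewrite !inE !negb_or => /and3P[xi xj xk].
by rewrite permM !tpermD // eq_sym.
Qed.

Lemma cycle3_rot i j k : uniq [:: i; j; k] -> cycle3 j k i = cycle3 i j k.
Proof.
move=> u; have u' : uniq [:: j; k; i] by rewrite -(rot_uniq 1) in u.
have [j1 k1 i1 o1] := cycle3E u'; have [j2 k2 i2 o2] := cycle3E u.
apply/permP => a; have [|an] := boolP (a \in [:: i; j; k]).
  by rewrite !inE => /or3P[] /eqP ->; congruence.
by rewrite o1 ?o2 // -(mem_rot 2).
Qed.

Definition triple_orientation w : Prop :=
  forall i j k, uniq [:: i; j; k] ->
    w [set i; j; k] = cycle3 i j k \/ w [set i; j; k] = cycle3 j i k.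

(* [enum t] lists the elements of [t] in increasing order; the value at sets
   that are not triples is irrelevant. *)
Definition canonical_orientation t : {perm 'I_N} :=
  if enum t is [:: i; j; k] then cycle3 i j k else 1%g.

Lemma canonical_orientationE i j k : i < j -> j < k ->
  canonical_orientation [set i; j; k] = cycle3 i j k.
Proof.
move=> ij jk; rewrite /canonical_orientation.
suff -> : enum [set i; j; k] = [:: i; j; k] by [].
have tr : transitive (fun x y : 'I_N => x < y) by move=> x y z; apply: ltn_trans.
apply: (irr_sorted_eq tr) => [x||| x]; first exact: ltnn.
- rewrite /enum_mem; apply: sorted_filter => //; rewrite -enumT.
  rewrite -(@sorted_map _ _ val ltn) val_enum_ord.
  exact: iota_ltn_sorted.
- by rewrite /= ij jk.
- by rewrite mem_enum !inE -orbA.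
Qed.

Lemma canonical_orientation_triple : triple_orientation canonical_orientation.
Proof.
move=> i j k u.
have u' : uniq [:: j; i; k].
  by rewrite (perm_uniq (permEl (perm_catCA [:: j] [:: i] [:: k]))).
have srt (x y z : 'I_N) : x < y -> y < z -> [set i; j; k] = [set x; y; z] ->
    canonical_orientation [set i; j; k] = cycle3 x y z.
  by move=> xy yz ->; apply: canonical_orientationE.
have E : cycle3 k i j = cycle3 i j k.
  by apply/esym/cycle3_rot; rewrite -(rot_uniq 1).
have E' : cycle3 k j i = cycle3 j i k.
  by apply/esym/cycle3_rot; rewrite -(rot_uniq 1).
have [ij ik jk] : [/\ i != j :> nat, i != k :> nat & j != k :> nat].
  by move: u; rewrite /= !inE negb_or andbT => /andP[/andP[]].
case: (ltngtP i j) ij => // ij _; case: (ltngtP j k) jk => // jk _;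
  case: (ltngtP i k) ik => // ik _;
  try by [move: (ltn_trans ij jk); rewrite ltnNge ltnW
         |move: (ltn_trans jk ij); rewrite ltnNge ltnW].
- by left; apply: srt.
- right; rewrite -(cycle3_rot u'); apply: srt => //; apply/setP => a.
  by rewrite !inE; case: (a == i); case: (a == j); case: (a == k).
- left; rewrite -E; apply: srt => //; apply/setP => a.
  by rewrite !inE; case: (a == i); case: (a == j); case: (a == k).
- right; apply: srt => //; apply/setP => a.
  by rewrite !inE; case: (a == i); case: (a == j); case: (a == k).
- left; rewrite -(cycle3_rot u); apply: srt => //; apply/setP => a.
  by rewrite !inE; case: (a == i); case: (a == j); case: (a == k).
- right; rewrite -E'; apply: srt => //; apply/setP => a.
  by rewrite !inE; case: (a == i); case: (a == j); case: (a == k).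
Qed.

(* [p] is the [N]-cycle (s(0) s(1) ... s(N-1)); [ordS] is the successor
   modulo [N]. *)
Definition is_long_cycle p s : bool := [forall i, p (s i) == s (ordS i)].

(* The factors are multiplied in the enumeration order of [T].  For [N] odd, [T]
   a spanning tree and [w] a triple orientation, a suitable [s] exists and its sign depends neither on
   that order nor on the choice of [s].  The value 0 means that the product is
   not an [N]-cycle. *)
Definition tree_sign T w : int :=
  if [pick s | is_long_cycle (\prod_(t in T) w t)%g s] is Some s
  then ((-1) ^+ odd_perm s)%R else 0%R.

Definition positive_trees w : {set {set {set 'I_N}}} :=
  [set T | spanning_tree3 (complete3 'I_N) T & tree_sign T w == 1%R].

Definition negative_trees w : {set {set {set 'I_N}}} :=
  [set T | spanning_tree3 (complete3 'I_N) T & tree_sign T w == (-1)%R].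

End TripleOrientations.

Arguments canonical_orientation N t : clear implicits.

(* Main.v *)
Require Import Defs.
From mathcomp Require Import all_boot all_algebra all_fingroup.
From mathcomp Require Import zify ring.

(* Attach to a triple [a < b < c] the bivector
   (e_a - e_c) /\ (e_b - e_c), which depends only on the cyclic order of a, b, c.
   For a set [T] of [n] triples and a vertex [q], the exterior product of these
   bivectors with [e_q] is the determinant of the corresponding rows.  It vanishes
   if [T] is disconnected (the indicator of the vertices not connected to [q] is
   in the kernel), hence whenever [T] is not a spanning tree, and it is the sign of
   [T] if [T] is a spanning tree (by adding leaf triples one at a time).  Summing
   over [q], i.e. replacing [e_q] by the all-ones vector [E], gives N = 2n + 1
   times the signed count.

   On the other hand the sum of all bivectors is, modulo [E], equal to
   N * sum_b p_b /\ p_(b+1) with p_b = e_0 + ... + e_(b-1), and therefore to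
   N * sum_(l < n) (p_(2l+1) - p_(2l+3)) /\ p_(2l+2).  As the p_b form a
   unitriangular basis, its n-th exterior power together with [E] is n! N^n, so
   the signed count is N^(n-1). *)

Set Implicit Arguments.
Unset Strict Implicit.
Unset Printing Implicit Defensive.

Import GRing.Theory.
Local Open Scope ring_scope.

(** * Determinants as alternating functions of sequences of rows *)

Section RowDeterminant.
Variable N : nat.
Implicit Types (s w r : seq 'rV[int]_N) (x y z : 'rV[int]_N).

(* Setting the value to 0 on sequences of the wrong length makes the
   multilinearity and alternation laws unconditional. *)
Definition rowdet s : int :=
  if size s == N then \det (\matrix_(i < N) nth 0 s i) else 0.

Lemma rowdet_linear w r a x y :
  rowdet (w ++ (a *: x + y) :: r)
  = a * rowdet (w ++ x :: r) + rowdet (w ++ y :: r).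
Proof.
rewrite /rowdet !size_cat /=; case: eqP => [sz|_]; last by rewrite mulr0 addr0.
have wN : (size w < N)%N by lia.
rewrite -[X in _ = _ + X]mul1r.
have E z : row (Ordinal wN) (\matrix_(i < N) nth 0 (w ++ z :: r) i) = z.
  by apply/rowP => j; rewrite !mxE nth_cat /= ltnn subnn.
have E' z z' : row' (Ordinal wN) (\matrix_(i < N) nth 0 (w ++ z :: r) i)
     = row' (Ordinal wN) (\matrix_(i < N) nth 0 (w ++ z' :: r) i).
  apply/matrixP => i j; rewrite !mxE !nth_cat.
  have := neq_lift (Ordinal wN) i; rewrite -val_eqE /=; set k := bump _ _.
  by case: ltngtP => // k1 _; rewrite -(subnSK k1).
by apply: (determinant_multilinear (i0 := Ordinal wN)); rewrite ?E ?scale1r.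
Qed.

Lemma rowdet_alternate w x r1 r2 : rowdet (w ++ x :: r1 ++ x :: r2) = 0.
Proof.
rewrite /rowdet; case: eqP => // sz; rewrite !size_cat /= size_cat /= in sz.
have i1N : (size w < N)%N by lia.
have i2N : (size w + (size r1).+1 < N)%N by lia.
apply: (@determinant_alternate _ _ _ (Ordinal i1N) (Ordinal i2N)).
  by rewrite -val_eqE /=; lia.
move=> j; rewrite !mxE !nth_cat /= ltnn subnn ltnNge leq_addr /= addKn /=.
by rewrite nth_cat ltnn subnn.
Qed.

(** Multiplying [A *m x = 0] by the adjugate of [A] gives [\det A *: x = 0], and [int] has no zero
    divisors. *)
Lemma rowdet_kernel s (x : 'cV[int]_N) :
  x != 0 -> {in s, forall y, y *m x = 0} -> rowdet s = 0.
Proof.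
move=> x0 sx; rewrite /rowdet; case: eqP => // sz; set A := matrix_of_fun _ _.
have Ax : A *m x = 0.
  apply/row_matrixP => i; rewrite row_mul row0.
  have -> : row i A = nth 0 s i by apply/rowP => j; rewrite !mxE.
  by apply/sx/mem_nth; rewrite sz.
have dx : \det A *: x = 0 by rewrite -mul_scalar_mx -mul_adj_mx -mulmxA Ax mulmx0.
have [/cV0Pn [i xi]] := x0; have /colP/(_ i)/eqP := dx.
by rewrite !mxE mulf_eq0 (negPf xi) orbF => /eqP.
Qed.

Lemma rowdetD w r x y :
  rowdet (w ++ (x + y) :: r) = rowdet (w ++ x :: r) + rowdet (w ++ y :: r).
Proof. by rewrite -[x in LHS]scale1r rowdet_linear mul1r. Qed.

Lemma rowdet0 w r : rowdet (w ++ 0 :: r) = 0.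
Proof.
by apply: (addrI (rowdet (w ++ 0 :: r))); rewrite -rowdetD !addr0.
Qed.

Lemma rowdetN w r x : rowdet (w ++ (- x) :: r) = - rowdet (w ++ x :: r).
Proof. by apply/eqP; rewrite -addr_eq0 -rowdetD addNr rowdet0. Qed.

Lemma rowdetB w r x y :
  rowdet (w ++ (x - y) :: r) = rowdet (w ++ x :: r) - rowdet (w ++ y :: r).
Proof. by rewrite rowdetD rowdetN. Qed.

Lemma rowdet_sum (I : Type) (P : pred I) (q : seq I) (F : I -> 'rV_N) w r :
  rowdet (w ++ (\sum_(i <- q | P i) F i) :: r)
  = \sum_(i <- q | P i) rowdet (w ++ F i :: r).
Proof.
by apply: (big_morph (fun x => rowdet (w ++ x :: r))) => [x y|];
  [apply: rowdetD | apply: rowdet0].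
Qed.

Lemma rowdet_swap w x y r :
  rowdet (w ++ x :: y :: r) = - rowdet (w ++ y :: x :: r).
Proof.
have := rowdet_alternate w (x + y) [::] r; rewrite cat0s rowdetD.
rewrite -!(cat_rcons _ w) !rowdetD !cat_rcons.
rewrite !(rowdet_alternate w _ [::] r) add0r addr0.
by move/eqP; rewrite addr_eq0 => /eqP.
Qed.

Lemma rowdet_move w x s r :
  rowdet (w ++ x :: s ++ r) = (-1) ^+ size s * rowdet (w ++ s ++ x :: r).
Proof.
elim: s w => [|y s IH] w; first by rewrite mul1r.
by rewrite /= rowdet_swap -cat_rcons IH cat_rcons exprS !mulNr mul1r.
Qed.

(** Each row of [s1] passes every row of [s2]; the sign is trivial as soon as one block has even
    length. *)
Lemma rowdet_block w s1 s2 r :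
  rowdet (w ++ s1 ++ s2 ++ r)
  = (-1) ^+ (size s1 * size s2)%N * rowdet (w ++ s2 ++ s1 ++ r).
Proof.
elim: s1 w => [|x s1 IH] w; first by rewrite mul1r.
rewrite -cat_rcons IH cat_rcons -/(cat (x :: s1) r) /= rowdet_move mulrA.
by rewrite -exprD mulSn addnC.
Qed.

Lemma rowdet_subr w x y r : y \in r ->
  rowdet (w ++ (x - y) :: r) = rowdet (w ++ x :: r).
Proof.
case/splitPr => r1 r2.
by rewrite rowdetB rowdet_alternate subr0.
Qed.

End RowDeterminant.

(** * The sum of the bivectors of all increasing triples *)

Section TripleSum.
Variable N : nat.

Definition prefix_row (k : nat) : 'rV[int]_N := \row_(j < N) (j < k)%N%:R.

Let e (i : 'I_N) : 'rV[int]_N := delta_mx 0 i.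

Lemma prefix_row0 : prefix_row 0 = 0.
Proof. by apply/rowP => j; rewrite !mxE. Qed.

Lemma prefix_rowE k : prefix_row k = \sum_(i < N | (i < k)%N) e i.
Proof.
apply/rowP => j; rewrite !mxE summxE; case: ltnP => jk.
  rewrite (bigD1 j) //= mxE !eqxx big1 ?addr0 // => i /andP[_ ij].
  by rewrite mxE eqxx eq_sym (negPf ij).
rewrite big1 // => i ik; rewrite mxE eqxx; case: eqP => // ji.
by rewrite -ji ltnNge jk in ik.
Qed.

Lemma prefix_rowS (b : 'I_N) : prefix_row b.+1 = prefix_row b + e b.
Proof.
by apply/rowP => j; rewrite !mxE -[j == b]val_eqE ltnS leq_eqVlt /=; case: ltngtP; rewrite ?addr0 ?add0r.
Qed.

Lemma suffix_rowE k :
  prefix_row N - prefix_row k = \sum_(i < N | (k <= i)%N) e i.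
Proof.
rewrite !prefix_rowE (bigID (fun i : 'I_N => (i < k)%N)) /=.
rewrite [X in X + _ - _](eq_bigl (fun i : 'I_N => (i < k)%N)); last first.
  by move=> i; rewrite ltn_ord.
by rewrite addrC addKr; apply: eq_bigl => i; rewrite ltn_ord -leqNgt.
Qed.

Lemma rowdet_prefix : rowdet [seq prefix_row i.+1 | i <- iota 0 N] = 1.
Proof.
rewrite /rowdet size_map size_iota eqxx det_trig.
  by rewrite big1 // => i _; rewrite !mxE (nth_map 0%N) ?size_iota // mxE nth_iota //= ltnSn.
apply/is_trig_mxP => i j ij.
by rewrite !mxE (nth_map 0%N) ?size_iota // mxE nth_iota // ltnS leqNgt ij.
Qed.

Variables w r : seq 'rV[int]_N.
Hypothesis all_ones : prefix_row N \in r.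
(** An alternating form. As the all-ones row occurs in [r], it is defined modulo that row, so the
    sum of [e c] over [b < c] acts as [- prefix_row b.+1]. *)
Let B x y := rowdet (w ++ x :: y :: r).

Let Bl x y z : B (x - y) z = B x z - B y z. Proof. exact: rowdetB. Qed.
Let Br x y z : B x (y - z) = B x y - B x z.
Proof. by rewrite /B -!(cat_rcons _ w) rowdetB. Qed.
Let BC x y : B x y = - B y x. Proof. exact: rowdet_swap. Qed.
Let Bxx x : B x x = 0. Proof. exact: (rowdet_alternate _ _ [::]). Qed.
Let B1 x : B x (prefix_row N) = 0.
Proof.
by rewrite /B -cat_rcons; case/splitPr: all_ones => *; apply: rowdet_alternate.
Qed.
Let Bsuml x P : \sum_(i < N | P i) B (e i) x = B (\sum_(i < N | P i) e i) x.
Proof. by rewrite /B rowdet_sum. Qed.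
Let Bsumr x P : \sum_(i < N | P i) B x (e i) = B x (\sum_(i < N | P i) e i).
Proof.
by rewrite /B -cat_rcons rowdet_sum; apply: eq_bigr => i _; rewrite cat_rcons.
Qed.

(** Fix the middle vertex b and expand the bivector as e_a /\ e_b + e_b /\ e_c - e_a /\ e_c. Modulo
    the all-ones row, the sum over a is p_b and the sum over c is -p_(b+1), so the three terms yield
    N - b - 1, b and 1 copies of p_b /\ p_(b+1). *)
Lemma sum_increasing_triples :
  \sum_(p : 'I_N * 'I_N * 'I_N | (p.1.1 < p.1.2)%N && (p.1.2 < p.2)%N)
     B (e p.1.1 - e p.2) (e p.1.2 - e p.2)
  = N%:R * \sum_(b < N) B (prefix_row b) (prefix_row b.+1).
Proof.
have -> : \sum_(p : 'I_N * 'I_N * 'I_N | (p.1.1 < p.1.2)%N && (p.1.2 < p.2)%N)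
     B (e p.1.1 - e p.2) (e p.1.2 - e p.2)
   = \sum_(b < N) \sum_(a < N | (a < b)%N) \sum_(c < N | (b < c)%N)
     B (e a - e c) (e b - e c).
  by rewrite [RHS](exchange_big_dep xpredT) //= !pair_big_dep; apply: eq_bigl.
rewrite big_distrr /=; apply: eq_bigr => b _.
have eb : e b = prefix_row b.+1 - prefix_row b by rewrite prefix_rowS addrC addKr.
have Be : B (prefix_row b) (e b) = B (prefix_row b) (prefix_row b.+1).
  by rewrite eb Br Bxx subr0.
have Bs x : \sum_(c < N | (b < c)%N) B x (e c) = - B x (prefix_row b.+1).
  by rewrite Bsumr -suffix_rowE Br B1 sub0r.
transitivity (\sum_(a < N | (a < b)%N) \sum_(c < N | (b < c)%N) B (e a) (e b)
  + \sum_(a < N | (a < b)%N) \sum_(c < N | (b < c)%N) B (e b) (e c)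
  - \sum_(a < N | (a < b)%N) \sum_(c < N | (b < c)%N) B (e a) (e c)).
  rewrite -big_split -sumrB; apply: eq_bigr => a _.
  rewrite -big_split -sumrB; apply: eq_bigr => c _ /=.
  by rewrite Bl !Br Bxx (BC (e c)); ring.
have -> : \sum_(a < N | (a < b)%N) \sum_(c < N | (b < c)%N) B (e a) (e c)
   = - B (prefix_row b) (prefix_row b.+1).
  by rewrite exchange_big /= (eq_bigr _ (fun i _ => Bsuml _ _)) -prefix_rowE Bs.
have -> : \sum_(a < N | (a < b)%N) \sum_(c < N | (b < c)%N) B (e b) (e c)
   = b%:R * B (prefix_row b) (prefix_row b.+1).
  have -> : B (prefix_row b) (prefix_row b.+1) = - B (e b) (prefix_row b.+1).
    by rewrite eb Bl Bxx sub0r opprK.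
  rewrite (eq_bigr _ (fun i _ => Bs _)) sumr_const mulr_natl; congr (_ *+ _).
  by rewrite -sum1_card (big_ord_narrow (ltnW (ltn_ord b))) sum1_card card_ord.
have -> : \sum_(a < N | (a < b)%N) \sum_(c < N | (b < c)%N) B (e a) (e b)
   = (N - b.+1)%:R * B (prefix_row b) (prefix_row b.+1).
  rewrite exchange_big /= (eq_bigr _ (fun i _ => Bsuml _ _)) -prefix_rowE Be.
  rewrite sumr_const mulr_natl; congr (_ *+ _); apply/eqP.
  rewrite -(eqn_add2r b.+1) subnK //.
  rewrite -[X in _ == X]card_ord -(cardC (fun i : 'I_N => (b < i)%N)) eqn_add2l.
  rewrite (eq_card (_ : _ =i (fun i : 'I_N => (i < b.+1)%N))); last first.
    by move=> i; rewrite !inE unfold_in [in RHS]unfold_in ltnS -leqNgt.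
  by rewrite -sum1_card (big_ord_narrow (ltn_ord b)) sum1_card card_ord.
have -> : N%:R = (N - b.+1)%:R + b%:R + 1 :> int.
  by rewrite -natrD natr1; congr (_ %:R); have := ltn_ord b; lia.
by ring.
Qed.

End TripleSum.

(** * Sums over sets of triples *)

(** Tuples with a repeated entry contribute 0, and each k-set is listed by k! injective tuples, all
    with the same value. *)
Lemma sum_symmetric_tuples (X : finType) k (F : seq X -> int) :
  (forall s1 s2, perm_eq s1 s2 -> F s1 = F s2) ->
  (forall s, ~~ uniq s -> F s = 0) ->
  \sum_(f : k.-tuple X) F f = k`!%:R * \sum_(A : {set X} | #|A| == k) F (enum A).
Proof.
move=> Fperm F0; rewrite (bigID (fun f : k.-tuple X => uniq f)) /=.
rewrite [X in _ + X]big1 ?addr0 => [|f]; last exact: F0.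
rewrite (partition_big (fun f : k.-tuple X => [set x in f])
  (fun A => #|A| == k)) /=; last first.
  by move=> f uf; rewrite cardsE (card_uniqP uf) size_tuple.
rewrite big_distrr; apply: eq_bigr => A /eqP cA /=.
rewrite (eq_bigr (fun _ => F (enum A))) => [|f /andP[uf /eqP <-]]; last first.
  by apply/Fperm/uniq_perm => // [|x]; rewrite ?enum_uniq // mem_enum inE.
rewrite sumr_const mulr_natl; congr (_ *+ _).
rewrite -[k`!]ffactnn -[X in (X ^_ _)%N]cA -card_uniq_tuples; apply: eq_card => f.
rewrite !inE unfold_in andbC; have [uf|] := boolP (uniq f); last by rewrite !andbF.
rewrite !andbT; apply/eqP/allP => [<- x xf|fA].
  by rewrite -[X in is_true X]/(x \in [set y in f]) inE.
apply/eqP; rewrite eqEcard cA cardsE (card_uniqP uf) size_tuple leqnn andbT.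
by apply/subsetP => x; rewrite inE; apply: fA.
Qed.

Lemma sum_tuple_cons (X : finType) k (F : seq X -> int) :
  \sum_(f : k.+1.-tuple X) F f = \sum_x \sum_(f : k.-tuple X) F (x :: f).
Proof.
rewrite pair_bigA /= (reindex (fun p : X * k.-tuple X => [tuple of p.1 :: p.2])) //=.
exists (fun f : k.+1.-tuple X => (thead f, [tuple of behead f])) => [[x f] _|f _].
  by rewrite /= theadE; congr (_, _); apply: val_inj.
by rewrite /= -tuple_eta.
Qed.

(** Raises a congruence modulo [v] to its k-th exterior power. The row [v] stays in the suffix while
    the blocks are exchanged: the later ones by induction, then the first one. *)
Lemma sum_rows_substitute N (X Y : finType) (a : X -> seq 'rV[int]_N)
    (b : Y -> seq 'rV[int]_N) (c : int) (v : 'rV[int]_N) :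
  (forall w r, v \in r ->
     \sum_x rowdet (w ++ a x ++ r) = c * \sum_y rowdet (w ++ b y ++ r)) ->
  forall k w r, v \in r ->
  \sum_(f : k.-tuple X) rowdet (w ++ flatten (map a f) ++ r)
  = c ^+ k * \sum_(g : k.-tuple Y) rowdet (w ++ flatten (map b g) ++ r).
Proof.
move=> ab; elim=> [|k IH] w r vr.
  rewrite mul1r (eq_bigr (fun _ => rowdet (w ++ r))) => [|f _]; last by rewrite (tuple0 f).
  rewrite [in RHS](eq_bigr (fun _ => rowdet (w ++ r))) => [|f _]; last by rewrite (tuple0 f).
  by rewrite !sumr_const !card_tuple.
rewrite (@sum_tuple_cons _ k (fun f => rowdet (w ++ flatten (map a f) ++ r))).
rewrite (@sum_tuple_cons _ k (fun f => rowdet (w ++ flatten (map b f) ++ r))) /=.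
transitivity (\sum_x c ^+ k *
    \sum_(g : k.-tuple Y) rowdet (w ++ a x ++ flatten (map b g) ++ r)).
  apply: eq_bigr => x _; rewrite (eq_bigr (fun f : k.-tuple X =>
    rowdet ((w ++ a x) ++ flatten (map a f) ++ r))) => [|f _]; last by rewrite -!catA.
  by rewrite IH //; congr (_ * _); apply: eq_bigr => g _; rewrite -!catA.
rewrite -big_distrr exprSr -mulrA /=; congr (_ * _).
rewrite exchange_big [in RHS]exchange_big big_distrr; apply: eq_bigr => g _ /=.
rewrite ab ?mem_cat ?vr ?orbT //; congr (_ * _); apply: eq_bigr => y _.
by rewrite -!catA.
Qed.

Lemma sum_pairs n (F : nat -> int) :
  \sum_(i < 2 * n) F i = \sum_(l < n) (F (2 * l)%N + F (2 * l).+1).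
Proof.
elim: n => [|n IH]; first by rewrite !big_ord0.
have -> : (2 * n.+1 = (2 * n).+2)%N by lia.
by rewrite !big_ord_recr /= IH addrA.
Qed.

Section Blocks.
Variables (N : nat) (T : eqType) (rows : T -> seq 'rV[int]_N).

(** Blocks of even length commute without a sign. *)
Lemma rowdet_perm_blocks s1 s2 w r :
  (forall x, ~~ odd (size (rows x))) -> perm_eq s1 s2 ->
  rowdet (w ++ flatten (map rows s1) ++ r)
  = rowdet (w ++ flatten (map rows s2) ++ r).
Proof.
move=> ev; elim: s1 s2 w => [|x s1 IH] s2 w; first by rewrite perm_sym => /perm_nilP ->.
move=> p12; have /splitPr E : x \in s2 by rewrite -(perm_mem p12) mem_head.
case: E p12 => a b; rewrite perm_sym -(cat1s x b) perm_catCA perm_cons perm_sym => pab.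
rewrite /= -catA catA (IH _ _ pab) !map_cat !flatten_cat /= -!catA rowdet_block.
by rewrite -signr_odd oddM (negPf (ev x)) mul1r.
Qed.

Lemma rowdet_repeated_block s w r :
  (forall x, rows x != [::]) -> ~~ uniq s -> rowdet (w ++ flatten (map rows s) ++ r) = 0.
Proof.
move=> ne; elim: s w => [//|x s IH] w /=; rewrite negb_and negbK => /orP[|us].
  case/splitPr => a b; rewrite map_cat flatten_cat /=.
  by case: (rows x) (ne x) => [//|y q] _; rewrite /= -!catA !(catA q) rowdet_alternate.
by rewrite -catA catA IH.
Qed.

End Blocks.

Lemma sum_block_tuples N (X : finType) (rows : X -> seq 'rV[int]_N) k r :
  (forall x, size (rows x) = 2) ->
  \sum_(f : k.-tuple X) rowdet (flatten (map rows f) ++ r)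
  = k`!%:R * \sum_(A : {set X} | #|A| == k) rowdet (flatten (map rows (enum A)) ++ r).
Proof.
move=> sz; apply: (@sum_symmetric_tuples _ _ (fun s => rowdet (flatten (map rows s) ++ r))).
  by move=> s1 s2; apply: (@rowdet_perm_blocks _ _ rows _ _ [::]) => x; rewrite sz.
move=> s; apply: (@rowdet_repeated_block _ _ rows _ [::]) => x.
by rewrite -size_eq0 sz.
Qed.


(** * The rows of a triple and their cyclic symmetry *)

Section TripleRows.
Variable N : nat.
Implicit Types (t : {set 'I_N}) (i j k : 'I_N).

Definition unit_row i : 'rV[int]_N := delta_mx 0 i.

(* The zero rows on sets that are not triples let the sums below range over all
   sets of vertices. *)
Definition triple_rows t : seq 'rV[int]_N :=
  if enum t is [:: a; b; c]
  then [:: unit_row a - unit_row c; unit_row b - unit_row c] else [:: 0; 0].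

Lemma sorted_enum_ord t : sorted (fun i j => (i < j)%N) (enum t).
Proof.
rewrite /enum_mem; apply: sorted_filter => [x y z|]; first exact: ltn_trans.
by rewrite -enumT -(@sorted_map _ _ val ltn) val_enum_ord iota_ltn_sorted.
Qed.

Lemma enum_set3 i j k : (i < j)%N -> (j < k)%N ->
  enum [set i; j; k] = [:: i; j; k].
Proof.
move=> ij jk.
have tr : transitive (fun x y : 'I_N => (x < y)%N).
  by move=> x y z; apply: ltn_trans.
apply: (irr_sorted_eq tr) => [x|||x]; first exact: ltnn.
- exact: sorted_enum_ord.
- by rewrite /= ij jk.
- by rewrite mem_enum !inE -orbA.
Qed.

Lemma enum_triple t : #|t| = 3 ->
  exists a b c, [/\ enum t = [:: a; b; c], (a < b)%N & (b < c)%N].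
Proof.
have := sorted_enum_ord t; rewrite cardE; case: (enum t) => [|a [|b [|c [|]]]] //= /and3P[ab bc _] _.
by exists a, b, c.
Qed.

Lemma enum_triple_set t a b c : enum t = [:: a; b; c] -> t = [set a; b; c].
Proof. by move=> E; apply/setP => x; rewrite -mem_enum E !inE orbA. Qed.

(** Sets that are not triples contribute a zero row; triples correspond to increasing [(a, b, c)],
    with [enum] inverting [f]. *)
Lemma sum_triple_rows w r : prefix_row N N \in r ->
  \sum_t rowdet (w ++ triple_rows t ++ r)
  = N%:R * \sum_(b < N) rowdet (w ++ prefix_row N b :: prefix_row N b.+1 :: r).
Proof.
move=> Er; rewrite -(sum_increasing_triples w Er).
rewrite (bigID (fun t => #|t| == 3)) /= [X in _ + X]big1 ?addr0; last first.
  move=> t; rewrite cardE /triple_rows; case: (enum t) => [|a [|b [|c [|]]]] //= *;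
  exact: rowdet0.
pose f (p : 'I_N * 'I_N * 'I_N) := [set p.1.1; p.1.2; p.2].
pose I := [set p : 'I_N * 'I_N * 'I_N | (p.1.1 < p.1.2)%N && (p.1.2 < p.2)%N].
have enumf p : p \in I -> enum (f p) = [:: p.1.1; p.1.2; p.2].
  by rewrite inE => /andP[ab bc]; apply: enum_set3.
rewrite (eq_bigl (fun t => t \in f @: I)) => [|t]; last first.
  apply/eqP/imsetP => [/enum_triple[a [b [c [Et ab bc]]]]|[p pI ->]].
    by exists (a, b, c); [rewrite inE ab bc | rewrite (enum_triple_set Et)].
  by rewrite cardE enumf.
rewrite big_imset /= => [|p q pI qI /(congr1 (fun t : {set 'I_N} => enum t))]; last first.
  by rewrite !enumf //; case: p q {pI qI} => [[? ?] ?] [[? ?] ?] /= [-> -> ->].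
rewrite (eq_bigl (fun p : 'I_N * 'I_N * 'I_N => (p.1.1 < p.1.2)%N && (p.1.2 < p.2)%N)) => [|p]; last by rewrite inE.
by apply: eq_bigr => p inc; rewrite /triple_rows enumf ?inE.
Qed.

(** Any vertex of the triple may serve as base point, as is needed when the triple is attached to a
    tree at [i]. One cyclic step is (e_1 - e_3) /\ (e_2 - e_3) = (e_1 - e_3) /\ (e_2 - e_1) = (e_2 -
    e_1) /\ (e_3 - e_1). *)
Lemma triple_rows_cyclic t i : #|t| = 3 -> i \in t ->
  exists j k, [/\ uniq [:: i; j; k], t = [set i; j; k],
    canonical_orientation N t = cycle3 i j k
    & forall w r, rowdet (w ++ triple_rows t ++ r)
      = rowdet (w ++ [:: unit_row j - unit_row i; unit_row k - unit_row i] ++ r)].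
Proof.
move=> /enum_triple[a [b [c [Et ab bc]]]] it.
have u : uniq [:: a; b; c] by rewrite -Et enum_uniq.
have dE x y w r : rowdet (w ++ [:: x; y] ++ r) = rowdet (w ++ [:: x; y - x] ++ r).
  rewrite /= -!(cat_rcons _ w) rowdetB !cat_rcons.
  by rewrite (rowdet_alternate _ _ [::]) subr0.
have rotE i1 i2 i3 w r :
    rowdet (w ++ [:: unit_row i1 - unit_row i3; unit_row i2 - unit_row i3] ++ r)
  = rowdet (w ++ [:: unit_row i2 - unit_row i1; unit_row i3 - unit_row i1] ++ r).
  rewrite dE opprB addrA subrK /= rowdet_swap -!(cat_rcons _ w) -rowdetN.
  by rewrite opprB.
have := it; rewrite -mem_enum Et !inE => /or3P[] /eqP E; subst i.
- exists b, c; split=> //; first exact: enum_triple_set.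
    by rewrite /canonical_orientation Et.
  by move=> w r; rewrite /triple_rows Et rotE.
- exists c, a; have u' : uniq [:: b; c; a] by rewrite -(rot_uniq 1) in u.
  split=> //; first by rewrite (enum_triple_set Et) -setUA setUC.
    by rewrite /canonical_orientation Et (cycle3_rot u).
  by move=> w r; rewrite /triple_rows Et 2!rotE.
exists a, b; have u' : uniq [:: c; a; b] by rewrite -(rot_uniq 2) in u.
split=> //; first by rewrite (enum_triple_set Et) setUC setUA.
  by rewrite /canonical_orientation Et -(cycle3_rot u').
by move=> w r; rewrite /triple_rows Et.
Qed.

End TripleRows.

(** * Evaluation of the n-th exterior power *)

Section MainSum.
Variable n : nat.
Let N := (2 * n + 1)%N.
Let ones := prefix_row N N.
Let NE : N = (2 * n).+1. Proof. exact: addn1. Qed.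
Let onesE : ones = prefix_row N (2 * n).+1. Proof. by congr prefix_row; rewrite NE. Qed.

(** Combines the two consecutive terms p_(2l+1) /\ p_(2l+2) and p_(2l+2) /\ p_(2l+3) into one
    bivector. *)
Let bridge (l : nat) : seq 'rV[int]_N :=
  [:: prefix_row N (2 * l).+1 - prefix_row N (2 * l).+3; prefix_row N (2 * l).+2].

(** Induction from the last bridge backwards: the rows already simplified begin with p_(2l+3), where
    l = n - m - 1 in the inductive step, so this term drops out of the first row of bridge [l]. *)
Lemma rowdet_bridges m w : (m <= n)%N ->
  rowdet (w ++ flatten [seq bridge l | l <- iota (n - m) m] ++ [:: ones])
  = rowdet (w ++ [seq prefix_row N i.+1 | i <- iota (2 * (n - m)) (2 * m).+1]).
Proof.
elim: m w => [|m IH] w mn; first by rewrite subn0 /= onesE.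
rewrite (_ : 2 * m.+1 = (2 * m).+2)%N; last by lia.
rewrite /= -subSn // subSS.
have := IH (w ++ bridge (n - m.+1)) (ltnW mn); rewrite -!catA => -> /=.
have -> : (2 * (n - m))%N = (2 * (n - m.+1)).+2 by lia.
by rewrite /= rowdet_subr // !inE eqxx orbT.
Qed.

Lemma sum_triple_sets :
  \sum_(A : {set {set 'I_N}} | #|A| == n)
    rowdet (flatten (map (@triple_rows N) (enum A)) ++ [:: ones]) = N%:R ^+ n.
Proof.
pose b (l : 'I_n) := bridge l.
have sumE w r : ones \in r -> \sum_t rowdet (w ++ @triple_rows N t ++ r)
    = N%:R * \sum_l rowdet (w ++ b l ++ r).
  move=> Er; rewrite sum_triple_rows //; congr (_ * _).
  pose F i := rowdet (w ++ prefix_row N i :: prefix_row N i.+1 :: r).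
  rewrite -[LHS]/(\sum_(i < N) F i).
  have -> : \sum_(i < N) F i = \sum_(i < (2 * n).+1) F i.
    by rewrite -!(big_mkord xpredT F) {1}NE.
  (* The term at 0 vanishes because p_0 = 0; the remaining 2n terms are grouped in pairs. *)
  rewrite big_ord_recl {1}/F prefix_row0 rowdet0 add0r /= (@sum_pairs n (fun i => F i.+1)).
  apply: eq_bigr => l _; rewrite /F /b /bridge /= rowdetB.
  by rewrite [in X in _ = _ - X]rowdet_swap opprK.
have On : ones \in [:: ones] by rewrite mem_head.
have fact0 : n`!%:R != 0 :> int by rewrite Num.Theory.pnatr_eq0 -lt0n fact_gt0.
apply: (mulfI fact0); rewrite -sum_block_tuples; last first.
  by move=> t; rewrite /triple_rows; case: (enum t) => [|? [|? [|? []]]].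
rewrite (sum_rows_substitute sumE n [::] On) /= mulrC; congr (_ * _).
rewrite (@sum_block_tuples _ _ b) //.
(* There are only n bridges, so a single n-set of them survives. *)
rewrite (big_pred1 [set: 'I_n]) => [|A]; last first.
  by rewrite /= eqEcard subsetT cardsT card_ord eqn_leq -[X in (_ <= X)%N && _](card_ord n) max_card.
have := @rowdet_bridges n [::] (leqnn n); rewrite subnn /= => bE.
rewrite (_ : map b _ = [seq bridge l | l <- iota 0 n]); last first.
  by rewrite -val_enum_ord -map_comp enum_setT -enumT.
rewrite bE muln0 -[RHS]mulr1; congr (_ * _); rewrite -[RHS](rowdet_prefix N).
by have -> : iota 0 N = 0%N :: iota 1 (2 * n) by rewrite NE.
Qed.

End MainSum.

(** * Hypertrees *)

Section Hypertrees.
Variable V : finType.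
Implicit Types (q x y z : V) (t u S : {set V}) (T : {set {set V}}) (ts us : seq {set V}).

Fixpoint verts q ts : {set V} := if ts is t :: ts' then t :|: verts q ts' else [set q].

(* The head of the sequence is the triple added last. *)
Fixpoint hypertree q ts : bool :=
  if ts is t :: ts'
  then [&& hypertree q ts', #|t| == 3 & #|t :&: verts q ts'| == 1] else true.

(** Weakens [hypertree]: a new triple may share two vertices with the old ones. This is what a
    greedy search from [q] produces. *)
Fixpoint grown q ts : bool :=
  if ts is t :: ts'
  then [&& grown q ts', #|t| == 3, t :&: verts q ts' != set0
         & ~~ (t \subset verts q ts')]
  else true.

Lemma subset_verts q ts t : t \in ts -> t \subset verts q ts.
Proof.
elim: ts => //= u ts IH; rewrite inE => /orP[/eqP->|/IH]; first exact: subsetUl.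
by move=> tS; apply: subset_trans tS (subsetUr _ _).
Qed.

Lemma root_verts q ts : q \in verts q ts.
Proof. by elim: ts => [|t ts IH] /=; rewrite inE // IH orbT. Qed.

Lemma hypertree_triple q ts t : hypertree q ts -> t \in ts -> #|t| = 3.
Proof.
elim: ts => //= u ts IH /and3P[ht /eqP u3 _]; rewrite inE => /orP[/eqP->//|].
exact: IH.
Qed.

Lemma card_verts_hypertree q ts : hypertree q ts -> #|verts q ts| = (2 * size ts).+1.
Proof.
elim: ts => [|t ts IH] /=; first by rewrite cards1.
by case/and3P=> /IH vE /eqP t3 /eqP t1; rewrite cardsU vE t3 t1; lia.
Qed.

Lemma grown_uniq q ts : grown q ts -> uniq ts.
Proof.
elim: ts => //= t ts IH /and4P[/IH-> _ _ tS]; rewrite andbT.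
by apply: contra tS; apply: subset_verts.
Qed.

(** Each triple adds at most two vertices, and exactly two when it meets the old ones once. Counting
    vertices thus detects hypertrees. *)
Lemma grown_hypertree q ts : grown q ts ->
  (#|verts q ts| <= (2 * size ts).+1 ?= iff hypertree q ts)%N.
Proof.
elim: ts => [|t ts IH] /=; first by rewrite cards1; split; rewrite ?eqxx.
case/and4P=> /IH [le eqE] /eqP t3; rewrite -card_gt0 => I0 _.
rewrite t3 eqxx -eqE /= cardsU t3.
have IS : (#|t :&: verts q ts| <= #|verts q ts|)%N by rewrite subset_leq_card ?subsetIr.
by split; first lia; lia.
Qed.

Lemma adjacent3_sym T : symmetric (adjacent3 T).
Proof. by move=> x y; apply: eq_existsb => t; rewrite [(x \in t) && _]andbC. Qed.

(** Triples are added greedily, with a lower bound on the number of vertices reached as induction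
    variable. *)
Lemma grown_spanning T q : {in T, forall t, #|t| = 3} ->
  (forall x, connect (adjacent3 T) q x) ->
  exists ts, [/\ grown q ts, {subset ts <= T} & verts q ts = [set: V]].
Proof.
move=> T3 conn.
suff [ts [gts sT Hm]] : exists ts, [/\ grown q ts, {subset ts <= T} &
    (#|V| <= #|verts q ts|)%N \/ verts q ts = setT].
  exists ts; split=> //; case: Hm => // le.
  by apply/eqP; rewrite eqEcard subsetT cardsT.
elim: {1}#|V| => [|m [ts [gts sT]]]; first by exists [::]; split=> //; left.
case=> [le|vT]; last by exists ts; split=> //; right.
have [vT|/eqP vnT] := verts q ts =P setT; first by exists ts; split=> //; right.
have [t /and3P[tT tI tS]|no] := pickP (fun t => [&& t \in T,
    t :&: verts q ts != set0 & ~~ (t \subset verts q ts)]).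
  exists (t :: ts); split=> [||]; first by rewrite /= gts T3 // tI tS.
    by move=> u; rewrite inE => /orP[/eqP->|/sT].
  left; apply: leq_ltn_trans le _; rewrite /= proper_card // properEneq subsetUr andbT.
  by apply: contra tS => /eqP->; apply: subsetUl.
case/negP: vnT; rewrite -subTset; apply/subsetP => x _.
(* No triple can be added, so the set reached is closed under adjacency; it contains [q], hence
   everything connected to [q]. *)
have cl : closed (adjacent3 T) (mem (verts q ts)).
  apply: intro_closed; first by apply/sym_connect_sym/adjacent3_sym.
  move=> y z /exists_inP[t tT /andP[yt zt]] yv.
  have := no t; rewrite /= tT /= => /negbT; rewrite negb_and !negbK.
  case/orP=> [/eqP/setP/(_ y)|/subsetP/(_ z zt)//].
  by rewrite !inE yt yv.
by have := closed_connect cl (conn x); rewrite root_verts => <-.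
Qed.

Fixpoint hpath x (p : seq V) us : bool :=
  match p, us with
  | y :: p', u :: us' => [&& x \in u, y \in u & hpath y p' us']
  | [::], [::] => true
  | _, _ => false
  end.

Lemma hpath_rcons x p us y u : hpath x p us -> last x p \in u -> y \in u ->
  hpath x (rcons p y) (rcons us u).
Proof.
elim: p us x => [|z p IH] [|v us] x //=; first by move=> _ -> ->.
by case/and3P=> -> -> /= /IH; apply.
Qed.

(** Produces the incidence condition of [is_cycle3] when [z] is the starting vertex. The endpoint
    [z] is kept free because the start changes during the induction. *)
Lemma hpath_cycle x p us t z : hpath x p us -> last x p \in t -> z \in t ->
  all2 (fun e (t : {set V}) => (e.1 \in t) && (e.2 \in t))
    (zip (x :: p) (rcons p z)) (rcons us t).
Proof.
elim: p us x => [|y p IH] [|v us] x //=; first by move=> _ -> ->.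
by case/and3P=> -> -> /= /IH; apply.
Qed.

Lemma hypertree_notin q t ts : hypertree q (t :: ts) -> t \notin ts.
Proof.
case/and3P=> _ /eqP t3 t1; apply: contraL t1 => /(subset_verts q)/setIidPl->.
by rewrite t3.
Qed.

(** The last triple [t] meets the older part only in [i], so a path between an old and a new vertex
    is a path to or from [i] extended by [t]. Confinement to [verts q ts] keeps the vertices
    distinct. *)
Lemma hypertree_path q ts x y : hypertree q ts ->
  x \in verts q ts -> y \in verts q ts -> x != y ->
  exists p us, [/\ hpath x p us, last x p = y, uniq (x :: p),
    {subset x :: p <= verts q ts} & uniq us && all [in ts] us].
Proof.
elim: ts x y => [|t ts IH] x y; first by move=> _ /set1P-> /set1P->; rewrite eqxx.
move=> htt; have tts := hypertree_notin htt.
case/and3P: htt => ht _ /cards1P[i tE]; rewrite /=; set S := verts q ts in tE *.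
have /setIP[it iS] : i \in t :&: S by rewrite tE set11.
have sub (us : seq {set V}) : uniq us && all [in ts] us -> 
    uniq (rcons us t) && all [in t :: ts] (rcons us t).
  case/andP=> uu /allP us_ts; rewrite rcons_uniq uu andbT all_rcons inE eqxx /=.
  apply/andP; split; first by apply: contra tts => /us_ts.
  by apply/allP => u /us_ts; rewrite !inE => ->; rewrite orbT.
have tS z : z \in t -> z \in S -> z = i.
  by move=> zt zS; apply/set1P; rewrite -tE inE zt.
have [xS|xS] := boolP (x \in S); have [yS|yS] := boolP (y \in S) => xU yU xy.
- have [p [us [hp lp up pS /andP[uu us_ts]]]] := IH x y ht xS yS xy.
  exists p, us; split=> // [z /pS|]; first by rewrite inE orbC => ->.
  by rewrite uu; apply/allP => u /(allP us_ts); rewrite !inE => ->; rewrite orbT.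
- have yt : y \in t by move: yU; rewrite inE (negPf yS) orbF.
  have [xi|xi] := eqVneq x i.
    exists [:: y], [:: t]; split=> //=.
    + by rewrite xi it yt.
    + by rewrite inE xy.
    + by move=> z; rewrite !inE => /orP[]/eqP->; rewrite ?xS ?yt ?orbT.
    + by rewrite inE eqxx.
  have [p [us [hp lp up pS /sub us_ts]]] := IH x i ht xS iS xi.
  exists (rcons p y), (rcons us t); split=> //.
  + by apply: hpath_rcons; rewrite ?lp.
  + by rewrite last_rcons.
  + rewrite -[X in is_true X]/(uniq (rcons (x :: p) y)) rcons_uniq up andbT.
    by apply: contra yS => /pS.
  + move=> z; rewrite -rcons_cons mem_rcons inE => /orP[/eqP->//|/pS zS].
    by rewrite inE zS orbT.
- have xt : x \in t by move: xU; rewrite inE (negPf xS) orbF.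
  have [yi|iy] := eqVneq i y.
    exists [:: y], [:: t]; split=> //=.
    + by rewrite -yi it xt.
    + by rewrite inE xy.
    + by move=> z; rewrite !inE => /orP[]/eqP->; rewrite ?xt ?yS ?orbT.
    + by rewrite inE eqxx.
  have [p [us [hp lp up pS us_ts]]] := IH i y ht iS yS iy.
  exists (i :: p), (t :: us); split=> //.
  + by rewrite /= xt it hp.
  + rewrite -[X in is_true X]/((x \notin i :: p) && uniq (i :: p)) up andbT.
    by apply: contra xS => /pS.
  + move=> z; rewrite inE => /orP[/eqP->//|/pS zS].
    by rewrite inE zS orbT.
  + have := sub us us_ts; rewrite rcons_uniq all_rcons /= => /andP[/andP[-> ->]] /andP[-> ->].
    by [].
have xt : x \in t by move: xU; rewrite inE (negPf xS) orbF.
have yt : y \in t by move: yU; rewrite inE (negPf yS) orbF.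
exists [:: y], [:: t]; split=> //=.
- by rewrite xt yt.
- by rewrite inE xy.
- by move=> z; rewrite !inE => /orP[]/eqP->; rewrite ?xt ?yt.
- by rewrite inE eqxx.
Qed.

(** A path in [ts] between two common vertices is closed to a cycle by [t]. *)
Lemma hypertree_chord T q ts t : hypertree q ts -> {subset ts <= T} ->
  t \in T -> t \notin ts -> (1 < #|t :&: verts q ts|)%N -> has_cycle3 T.
Proof.
move=> ht sT tT tts /card_gt1P[x [y [/setIP[xt xS] /setIP[yt yS] xy]]].
have [p [us [hp lp up _ /andP[uu us_ts]]]] := hypertree_path ht xS yS xy.
apply/has_cycle3P; exists (x :: p), (rcons us t); apply/and5P; split=> //.
- by case: p lp {hp up} => //= E; rewrite E eqxx in xy.
- by rewrite rcons_uniq uu andbT; apply: contra tts => /(allP us_ts).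
- by rewrite all_rcons /= tT; apply/allP => u /(allP us_ts)/sT.
- by rewrite rot1_cons; apply: hpath_cycle; rewrite ?lp.
Qed.

Lemma acyclic_grown_hypertree T q ts : ~~ has_cycle3 T -> {subset ts <= T} ->
  grown q ts -> hypertree q ts.
Proof.
move=> nc; elim: ts => //= t ts IH sT /and4P[gts t3 tI tS].
have sT' : {subset ts <= T} by move=> u uts; apply: sT; rewrite inE uts orbT.
have ht := IH sT' gts; rewrite ht t3 /= eqn_leq card_gt0 tI andbT leqNgt.
apply: contra nc; apply: (hypertree_chord ht) => //; first by apply: sT; rewrite mem_head.
by apply: contra tS; apply: subset_verts.
Qed.

(** Greedy search reaches every vertex; a triple of [T] left over would be a chord and create a
    cycle. *)
Lemma spanning_tree_hypertree T q : spanning_tree3 (complete3 V) T ->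
  exists ts, [/\ hypertree q ts, perm_eq ts (enum T) & verts q ts = [set: V]].
Proof.
case/and4P=> /subsetP T3 nc _ /forallP conn.
have T3' : {in T, forall t, #|t| = 3} by move=> t /T3; rewrite inE => /eqP.
have [ts [gts sT vT]] := grown_spanning T3' (fun x => forallP (conn q) x).
have ht := acyclic_grown_hypertree nc sT gts.
exists ts; split=> //; apply: uniq_perm; rewrite ?enum_uniq ?(grown_uniq gts) // => t.
rewrite mem_enum; apply/idP/idP => [/sT//|tT]; apply: contraNT nc => tts.
by apply: (hypertree_chord ht sT tT tts); rewrite vT setIT T3'.
Qed.

(** If the last triple [t] is not on the cycle, it can be discarded. If it is [u k], then [a k] and
    its successor also lie on the neighbouring, older triples, so [t] meets the older part twice. *)
Lemma hypertree_no_cycle q ts l (a : nat -> V) (u : nat -> {set V}) :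
  hypertree q ts -> (1 < l)%N ->
  (forall k, (k < l)%N -> [/\ a k \in u k, a (k.+1 %% l)%N \in u k & u k \in ts]) ->
  (forall k k', (k < l)%N -> (k' < l)%N -> a k = a k' -> k = k') ->
  (forall k k', (k < l)%N -> (k' < l)%N -> u k = u k' -> k = k') -> False.
Proof.
move=> + l1 au ainj uinj; elim: ts au => [|t ts IH] au; first by have [_ _] := au 0%N (ltnW l1).
move=> /= /and3P[ht t3 t1].
have [/existsP[k /eqP uk]|/existsPn no] := boolP [exists k : 'I_l, u k == t]; last first.
  apply: IH ht => k kl; have [ak ak1] := au k kl; rewrite inE => /orP[/eqP ut|->//].
  by have := no (Ordinal kl); rewrite /= ut eqxx.
have kl := ltn_ord k; have [ak ak1 _] := au k kl.
have inS k' x : (k' < l)%N -> k' <> k -> x \in u k' -> x \in verts q ts.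
  move=> k'l kk' xu; have [_ _] := au k' k'l; rewrite inE => /orP[/eqP E|].
    by case: kk'; apply: uinj; rewrite // E uk.
  by move=> /(subset_verts q)/subsetP; apply.
pose k1 := (k.+1 %% l)%N; have k1l : (k1 < l)%N by rewrite ltn_mod; lia.
have kk1 : k1 <> k.
  rewrite /k1; have [E|E] := eqVneq k.+1 l; first by rewrite E modnn; lia.
  by rewrite modn_small; lia.
(* Cyclic predecessor of [k]; both it and the successor [k1] differ from [k] since the length is at
   least 2. *)
pose k0 := (if k == 0%N :> nat then l.-1 else k.-1)%N.
have k0l : (k0 < l)%N by rewrite /k0; case: ifP; lia.
have k0k : k0 <> k by rewrite /k0; case: ifP; lia.
have k0E : (k0.+1 %% l = k)%N.
  rewrite /k0; case: eqP => [->|]; first by rewrite prednK ?modnn; lia.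
  by move=> kn0; rewrite prednK ?modn_small; lia.
have : (1 < #|t :&: verts q ts|)%N.
  apply/card_gt1P; exists (a k), (a k1); rewrite !inE -uk ak ak1 /=; split.
  - apply: (inS k0) => //; have [_ + _] := au k0 k0l; by rewrite k0E.
  - by apply: (inS k1) => //; case: (au k1 k1l).
  by apply/eqP => /(ainj _ _ kl k1l) E; case: kk1.
by rewrite (eqP t1).
Qed.

Lemma hypertree_acyclic T q ts : hypertree q ts -> T =i ts -> ~~ has_cycle3 T.
Proof.
move=> ht Tts; apply/negP => /has_cycle3P[a [us /and5P[l1 ua uu us_T]]].
rewrite all2E size_zip size_rot minnn => /andP[/eqP sz al].
have [x0 _] : exists x0 : V, true by case: a l1 {ua sz al} => // x0; exists x0.
apply: (@hypertree_no_cycle q ts (size a) (nth x0 a) (nth set0 us) ht l1).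
- move=> k kl; rewrite -Tts (allP us_T) ?mem_nth -?sz //.
  have := all_nthP ((x0, x0), set0) al k.
  rewrite size_zip size_zip size_rot minnn -sz minnn => /(_ kl).
  rewrite nth_zip ?size_zip ?size_rot ?minnn // nth_zip ?size_rot //=.
  case/andP=> -> ; rewrite /rot nth_cat size_drop nth_drop add1n.
  have [E|E] := eqVneq k.+1 (size a).
    rewrite [X in if X then _ else _](_ : _ = false); last by lia.
    rewrite (_ : (k - _ = 0)%N); last by lia.
    by rewrite nth_take // E modnn.
  rewrite [X in if X then _ else _](_ : _ = true); last by lia.
  by rewrite modn_small //; lia.
- by move=> k k' kl k'l /eqP; rewrite nth_uniq // => /eqP.
- by move=> k k' kl k'l /eqP; rewrite nth_uniq -?sz // => /eqP.
Qed.

(** Greedy search gives #|V| <= 2 * size ts + 1 <= 2 * #|T| + 1 = #|V|. Equality forces all triples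
    to be used and each to add two vertices. *)
Lemma connected_spanning_tree T q : {in T, forall t, #|t| = 3} ->
  (2 * #|T|).+1 = #|V| -> (0 < #|T|)%N ->
  (forall x, connect (adjacent3 T) q x) -> spanning_tree3 (complete3 V) T.
Proof.
move=> T3 Tn T0 conn; have [ts [gts sT vT]] := grown_spanning T3 conn.
have [le leE] := grown_hypertree gts; rewrite vT cardsT in le leE.
have szts : (size ts <= #|T|)%N.
  by rewrite cardE uniq_leq_size ?(grown_uniq gts) // => t /sT; rewrite mem_enum.
have sz : size ts = #|T| by lia.
have ht : hypertree q ts by rewrite -leE sz Tn.
have Tts : T =i ts.
  have ts_enum : {subset ts <= enum T} by move=> u /sT; rewrite mem_enum.
  have [|_ E] := uniq_min_size (grown_uniq gts) ts_enum; first by rewrite -cardE sz.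
  by move=> t; rewrite -mem_enum E.
have conn2 x y : connect (adjacent3 T) x y.
  have sym := sym_connect_sym (@adjacent3_sym T).
  by apply: connect_trans (conn y); rewrite sym.
apply/and4P; split; last by apply/forallP => x; apply/forallP => y.
- by apply/subsetP => t /T3; rewrite inE => ->.
- exact: hypertree_acyclic ht Tts.
rewrite -subTset; apply/subsetP => x _.
(* Covering: [x] is connected to some other vertex, and the first step of such a path lies in a
   triple containing [x]. *)
have /card_gt1P[y [z [_ _ yz]]] : (1 < #|V|)%N by lia.
have [y' xy'] : exists y', x != y'.
  have [xy|] := eqVneq x y; [by exists z; rewrite xy | by exists y].
have /connectP[[|x1 p] /= pth lst] := conn2 x y'; first by rewrite lst eqxx in xy'.
case/andP: pth => /exists_inP[t tT /andP[xt _]] _.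
by apply/bigcupP; exists t.
Qed.

End Hypertrees.

(** * The sign of a spanning tree *)

(** The default value [x] of [nth] encodes the return from the last entry to the head. *)
Lemma next_cons (T : eqType) (x y : T) p :
  next (x :: p) y = if y \in x :: p then nth x p (index y (x :: p)) else y.
Proof. exact: next_nth. Qed.

Section TreeProduct.
Variable N : nat.
Implicit Types (q i j k x : 'I_N) (t : {set 'I_N}) (ts : seq {set 'I_N}).
Implicit Types (l : seq 'I_N) (w r : seq 'rV[int]_N).

Let sigma := canonical_orientation N.
Let urow := @unit_row N.

(** A rotation exchanges two blocks of odd total length, so one of them is even. *)
Lemma rowdet_rot m l w r : odd (size l) ->
  rowdet (w ++ map urow (rot m l) ++ r) = rowdet (w ++ map urow l ++ r).
Proof.
move=> ol; rewrite map_rot -[in RHS](cat_take_drop m (map urow l)) /rot -!catA rowdet_block.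
set s := map urow l; rewrite -signr_odd oddM.
have : odd (size (take m s) + size (drop m s)).
  by rewrite -size_cat cat_take_drop size_map.
by rewrite oddD; case: odd; case: odd => //= _; rewrite mul1r.
Qed.

Lemma canonicalE t i : #|t| = 3 -> i \in t ->
  exists j k, [/\ uniq [:: i; j; k], t = [set i; j; k],
   [/\ sigma t i = j, sigma t j = k, sigma t k = i &
     forall x, x \notin t -> sigma t x = x]
    & forall w r, rowdet (w ++ triple_rows t ++ r)
      = rowdet (w ++ [:: urow j - urow i; urow k - urow i] ++ r)].
Proof.
move=> t3 it; have [j [k [u tE sE rE]]] := triple_rows_cyclic t3 it.
exists j, k; split=> //; rewrite /sigma sE; have [? ? ? o] := cycle3E u.
by split=> // x; rewrite tE !inE -!orbA => xt; apply: o; rewrite !inE.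
Qed.

Lemma prod_canonical_fix ts x : {in ts, forall t, #|t| = 3} ->
  {in ts, forall t, x \notin t} -> (\prod_(t <- ts) sigma t)%g x = x.
Proof.
elim: ts => [|t ts IH] t3 xt; first by rewrite big_nil perm1.
rewrite big_cons permM; have ttt := mem_head t ts.
have /card_gt0P[i it] : (0 < #|t|)%N by rewrite t3.
have [j [k [_ _ [_ _ _ so] _]]] := canonicalE (t3 t ttt) it.
rewrite so ?xt //.
by apply: IH => u uts; [apply: t3 | apply: xt]; rewrite inE uts orbT.
Qed.

(* The new triple [i j k] has only [i] in the old tree.  Since the factors on its
   right fix [j] and [k], moving it to the end of the product turns it into the
   3-cycle [B i, j, k], which inserts [j, k] before [B i] in the old cycle. *)
Lemma hypertree_prod_cycle q ts ts' : hypertree q ts -> perm_eq ts' ts ->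
  exists l, [/\ uniq l, l =i verts q ts, (\prod_(t <- ts') sigma t)%g =1 next l
    & forall w, rowdet (w ++ flatten (map (@triple_rows N) ts) ++ [:: urow q])
      = rowdet (w ++ map urow l)].
Proof.
elim: ts ts' => [|t ts IH] ts' /=.
  move=> _ /perm_nilP ->; exists [:: q]; split=> // x; first by rewrite !inE.
  by rewrite big_nil perm1 next_cons mem_seq1 nth_nil; case: eqP.
move=> /and3P[ht /eqP t3 /cards1P[i tE]] pts.
have /splitPr E : t \in ts' by rewrite (perm_mem pts) mem_head.
case: E pts => a b; rewrite -(cat1s t b) perm_catCA perm_cons => pab.
have [l [ul lS lP lD]] := IH (a ++ b) ht pab.
have /setIP[it iS] : i \in t :&: verts q ts by rewrite tE set11.
have tS z : z \in t -> z \in verts q ts -> z = i.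
  by move=> zt zS; apply/set1P; rewrite -tE inE zt.
have [j [k [u ijk [si sj sk so] rE]]] := canonicalE t3 it.
move: u; rewrite /= !inE negb_or andbT => /andP[/andP[ij ik] jk].
have jt : j \in t by rewrite ijk !inE eqxx orbT.
have kt : k \in t by rewrite ijk !inE eqxx orbT.
have jS : j \notin verts q ts by apply: contra ij => /(tS _ jt) ->.
have kS : k \notin verts q ts by apply: contra ik => /(tS _ kt) ->.
have ab3 : {in a ++ b, forall u : {set 'I_N}, #|u| = 3}.
  by move=> u; rewrite (perm_mem pab); apply: hypertree_triple ht.
have fixab c x : {subset c <= a ++ b} -> x \notin verts q ts ->
    (\prod_(t <- c) sigma t)%g x = x.
  move=> cab xS; apply: prod_canonical_fix => u /cab uab; first exact: ab3.
  by apply: contra xS; apply/subsetP/subset_verts; rewrite -(perm_mem pab).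
pose A := (\prod_(t <- a) sigma t)%g; pose B := (\prod_(t <- b) sigma t)%g.
have a_ab : {subset a <= a ++ b} by move=> u ua; rewrite mem_cat ua.
have b_ab : {subset b <= a ++ b} by move=> u ub; rewrite mem_cat ub orbT.
have [Aj Ak] : A j = j /\ A k = k by split; apply: fixab.
have [Bj Bk] : B j = j /\ B k = k by split; apply: fixab.
have ABE x : B (A x) = next l x by rewrite -lP big_cat permM.
(* Otherwise [B] would fix [B i], and injectivity would give B i = i, a vertex of the old tree. *)
have Bil : B i \in l.
  apply: contraT; rewrite lS => BiS.
  have BBi : B (B i) = B i by apply: fixab.
  by rewrite (perm_inj BBi) iS in BiS.
have [m l' lrot] := rot_to Bil.
have nextl x : next l x = next (B i :: l') x by rewrite -lrot next_rot.
have ul' : uniq (B i :: l') by rewrite -lrot rot_uniq.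
have idx x : x \in B i :: l' -> (index x (B i :: l') <= size l')%N.
  by rewrite -index_mem ltnS.
have ml x : x \in B i :: l' = (x \in verts q ts) by rewrite -lrot mem_rot lS.
exists [:: j, k, B i & l']; split.
- rewrite -[X in is_true X]/[&& j \notin [:: k, B i & l'], k \notin B i :: l' & uniq (B i :: l')].
  by rewrite ul' in_cons !ml (negPf jk) (negPf jS) (negPf kS).
- move=> x; rewrite 2!in_cons ml ijk !inE; case: eqP => [->|_]; first by rewrite orbT.
  case: eqP => [->|_]; first by rewrite orbT.
  by rewrite !orbF /=; case: eqP => // ->.
- move=> x; rewrite big_cat big_cons !permM -/A -/B next_cons.
  have [->|xj] := eqVneq x j; first by rewrite Aj sj Bk mem_head /= eqxx.
  have [->|xk] := eqVneq x k.
    by rewrite Ak sk 2!inE eqxx orbT /= eqxx (negPf jk).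
  rewrite 2!in_cons (negPf xj) (negPf xk) /=.
  rewrite [j == x]eq_sym [k == x]eq_sym (negPf xj) (negPf xk) /=.
  have Axj : A x != j by apply: contra xj => /eqP; rewrite -{1}Aj => /perm_inj->.
  have Axk : A x != k by apply: contra xk => /eqP; rewrite -{1}Ak => /perm_inj->.
  have nx := ABE x; rewrite nextl next_cons in nx.
  rewrite -[if B i == x then _ else _]/(index x (B i :: l')).
  have [Axi|Axi] := eqVneq (A x) i.
    (* Here [x] precedes [B i] in the old cycle, so it is the last entry of the rotated list and its
       successor is the default value, now [j]. *)
    rewrite Axi si Bj; rewrite Axi in nx; case: ifP nx => [xl nx|xl nx].
      have := idx x xl; rewrite leq_eqVlt => /orP[/eqP->|lt]; first by rewrite nth_default.
      by move: ul'; rewrite cons_uniq {1}nx mem_nth.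
    by rewrite -nx mem_head in xl.
  rewrite so; last by rewrite ijk !inE !negb_or Axi Axj Axk.
  rewrite nx; case: ifP => // xl; apply: set_nth_default.
  have := idx x xl; rewrite leq_eqVlt => /orP[/eqP E|//].
  rewrite xl E nth_default // in nx; by rewrite (perm_inj nx) eqxx in Axi.
move=> w; rewrite -catA rE catA lD -catA /=.
(* The row of [i] is among those of [l], so it can be subtracted away; as [l] has odd length,
   rotating it then costs no sign. *)
have -> : rowdet (w ++ [:: urow j - urow i, urow k - urow i & map urow l])
        = rowdet (w ++ [:: urow j, urow k & map urow l]).
  have il : urow i \in map urow l by rewrite map_f // lS.
  rewrite rowdet_subr ?inE ?il ?orbT // -!(cat_rcons _ w) rowdet_subr //.
have ol : odd (size l).
  by rewrite -(card_uniqP ul) (eq_card lS) card_verts_hypertree //= oddM.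
have := rowdet_rot m (rcons (rcons w (urow j)) (urow k)) [::] ol.
by rewrite !cats0 lrot !cat_rcons => <-.
Qed.

End TreeProduct.

Lemma odd_permX (T : finType) (s : {perm T}) m : odd_perm (s ^+ m)%g = odd m && s.
Proof.
elim: m => [|m IH]; first by rewrite expg0 odd_perm1.
by rewrite expgS odd_permM IH /=; case: odd; case: odd_perm.
Qed.

(** * Long cycles and the sign of their listings *)

Section LongCycles.
Variable N : nat.
Implicit Types (p s : {perm 'I_N}) (l : seq 'I_N).

(* Two solutions differ by a power of the successor modulo [N], a permutation of
   odd order. *)
Lemma long_cycle_sign p s1 s2 : odd N ->
  is_long_cycle p s1 -> is_long_cycle p s2 -> odd_perm s1 = odd_perm s2.
Proof.
move=> oN /forallP l1 /forallP l2.
have N0 : (0 < N)%N by case: N oN.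
pose c := perm (@ordS_inj N).
have cE (i : 'I_N) m : (c ^+ m)%g i = ((i + m) %% N)%N :> nat.
  elim: m => [|m IH]; first by rewrite expg0 perm1 addn0 modn_small.
  by rewrite expgSr permM permE /= IH -addn1 modnDml addn1 addnS.
pose g := (s2 * s1^-1)%g; pose i0 := Ordinal N0.
have gc i : g (c i) = c (g i).
  rewrite !permM; apply: (@perm_inj _ s1); rewrite permKV permE -(eqP (l2 i)).
  by rewrite permE -(eqP (l1 _)) permKV.
have gcm m i : g ((c ^+ m)%g i) = (c ^+ m)%g (g i).
  by elim: m => [|m IH]; rewrite ?expg0 ?perm1 // expgSr 2!(permM (c ^+ m)%g) gc IH.
have ci (i : 'I_N) : i = (c ^+ i)%g i0 by apply: ord_inj; rewrite cE add0n modn_small.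
(* A permutation commuting with the successor is determined by its value at 0. *)
have gE : g = (c ^+ g i0)%g.
  apply/permP => i; rewrite {1}(ci i) gcm [in LHS](ci (g i0)) -!permM -!expgD addnC.
  by rewrite expgD permM -ci.
have cN : (c ^+ N)%g = 1%g.
  by apply/permP => i; apply: ord_inj; rewrite cE perm1 modnDr modn_small.
have oc : odd_perm c = false.
  by have := odd_permX c N; rewrite cN odd_perm1 oN.
have : odd_perm g = false by rewrite gE odd_permX oc andbF.
by rewrite odd_permM odd_permV; case: odd_perm; case: odd_perm.
Qed.

(** Take for [s] the map sending [i] to the i-th entry of [l]; the rows then form its permutation
    matrix. *)
Lemma rowdet_long_cycle p l : odd N -> uniq l -> size l = N -> p =1 next l ->
  exists2 s, is_long_cycle p s
    & rowdet (map (@unit_row N) l) = (-1) ^+ odd_perm s.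
Proof.
move=> oN ul sz pl; have N0 : (0 < N)%N by case: N oN.
pose i0 := Ordinal N0.
have injl : injective (fun i : 'I_N => nth i0 l i).
  by move=> i j /eqP; rewrite nth_uniq ?sz // => /eqP/val_inj.
exists (perm injl).
  apply/forallP => i; rewrite !permE pl; apply/eqP.
  have il : (i < size l)%N by rewrite sz.
  have xl := mem_nth i0 il; have ix := index_uniq i0 il ul.
  have -> : nth i0 l (ordS i) = nth i0 l (i.+1 %% size l)%N by rewrite /= sz.
  case: l {sz pl injl} ul il xl ix => // y l' ul il xl ix; rewrite next_cons xl ix.
  have := il; rewrite /= ltnS leq_eqVlt => /orP[/eqP E|lt].
    by rewrite E modnn nth_default.
  by rewrite modn_small //=; apply: set_nth_default.
rewrite /rowdet size_map sz eqxx -det_perm; congr (\det _).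
apply/matrixP => i j; rewrite !mxE (nth_map i0) ?sz // mxE eqxx /= permE.
by rewrite eq_sym.
Qed.

End LongCycles.

(** * The signed count of spanning trees *)

Section TreeSum.
Variable n : nat.
Hypothesis n_gt0 : (0 < n)%N.
Let N := (2 * n + 1)%N.
Implicit Types (T : {set {set 'I_N}}) (q : 'I_N).

Let NE : N = (2 * n).+1. Proof. exact: addn1. Qed.
Let oN : odd N. Proof. by rewrite NE /= oddM. Qed.

Let tree_rows T := flatten (map (@triple_rows N) (enum T)).

(** The determinant equals the sign for every root [q]. The last clause shows that the default value
    0 of [tree_sign] does not occur. *)
Lemma tree_sign_rowdet T q : spanning_tree3 (complete3 'I_N) T ->
  [/\ #|T| = n, tree_sign T (canonical_orientation N) = rowdet (tree_rows T ++ [:: unit_row q])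
    & exists b : bool, tree_sign T (canonical_orientation N) = (-1) ^+ b].
Proof.
move=> /(spanning_tree_hypertree q)[ts [ht pts vT]].
have Tn : #|T| = n.
  have := card_verts_hypertree ht; rewrite vT cardsT card_ord (perm_size pts) -cardE.
  by rewrite [X in X = _]NE => -[] /eqP; rewrite eqn_pmul2l // => /eqP.
have pst : perm_eq [seq t <- index_enum _ | t \in T] ts.
  rewrite perm_sym; apply: perm_trans pts _; apply: uniq_perm; first exact: enum_uniq.
    exact/filter_uniq/index_enum_uniq.
  by move=> t; rewrite [RHS]mem_filter mem_index_enum andbT mem_enum.
have [l [ul lS lP lD]] := hypertree_prod_cycle ht pst.
have szl : size l = N.
  by rewrite -(card_uniqP ul) (eq_card lS) vT cardsT card_ord.
have [s lc sE] := rowdet_long_cycle oN ul szl lP.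
have DE : rowdet (tree_rows T ++ [:: unit_row q]) = (-1) ^+ odd_perm s.
  rewrite -sE -[RHS](lD [::]); apply: (rowdet_perm_blocks [::]); last by rewrite perm_sym.
  by move=> t; rewrite /triple_rows; case: (enum t) => [|? [|? [|? []]]].
rewrite /tree_sign -big_filter DE; case: pickP => [s' lc'|/(_ s)]; last by rewrite lc.
by rewrite (long_cycle_sign oN lc' lc); split=> //; exists (odd_perm s).
Qed.

Lemma disconnected_rowdet T q y : ~~ connect (adjacent3 T) q y ->
  rowdet (tree_rows T ++ [:: unit_row q]) = 0.
Proof.
move=> qy; pose x : 'cV[int]_N := \col_i (~~ connect (adjacent3 T) q i)%:R.
have ux i : unit_row i *m x = (~~ connect (adjacent3 T) q i)%:R%:M.
  by rewrite /unit_row -rowE; apply/matrixP => a b; rewrite !mxE !ord1 eqxx mulr1n.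
(* Vertices of one triple lie in one component, so the difference rows annihilate [x]. *)
have same t a c : t \in T -> a \in t -> c \in t ->
    connect (adjacent3 T) q a = connect (adjacent3 T) q c.
  move=> tT ta tc; have sym := sym_connect_sym (@adjacent3_sym _ T).
  apply: (same_connect_r sym); apply: connect1.
  by apply/exists_inP; exists t; rewrite ?ta.
apply: (@rowdet_kernel _ _ x).
  by apply/cV0Pn; exists y; rewrite mxE qy.
move=> r; rewrite mem_cat mem_seq1 => /orP[/flattenP[rs /mapP[t]]|/eqP ->]; last first.
  by rewrite ux connect0 /= raddf0.
rewrite mem_enum => tT ->; rewrite /triple_rows.
case Et: (enum t) => [|a [|b [|c [|]]]]; rewrite !inE => /orP[]/eqP ->; rewrite ?mul0mx //.
  rewrite mulmxBl !ux (same t a c) ?subrr // -mem_enum Et !inE eqxx ?orbT //.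
rewrite mulmxBl !ux (same t b c) ?subrr // -mem_enum Et !inE eqxx ?orbT //.
Qed.

(** A member that is not a triple gives a zero row; otherwise [T] must be disconnected, since n
    triples connecting 2n + 1 vertices form a tree. *)
Lemma not_tree_rowdet T q : #|T| = n -> ~~ spanning_tree3 (complete3 'I_N) T ->
  rowdet (tree_rows T ++ [:: unit_row q]) = 0.
Proof.
move=> Tn; have [/forall_inP T3|] := boolP [forall t in T, #|t| == 3]; last first.
  rewrite negb_forall_in => /exists_inP[t tT t3] _.
  rewrite /tree_rows; have /splitPr[s1 s2] : t \in enum T by rewrite mem_enum.
  rewrite map_cat flatten_cat /=; have [r ->] : exists r, triple_rows t = 0 :: r.
    move: t3; rewrite cardE /triple_rows.
    by case: (enum t) => [|? [|? [|? []]]] //= *; exists [:: 0].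
  by rewrite -catA rowdet0.
have [/forallP conn|/forallPn[y]] := boolP [forall y, connect (adjacent3 T) q y].
  rewrite (@connected_spanning_tree _ T q) ?Tn ?card_ord ?NE //.
  by move=> t /T3/eqP.
by move=> /disconnected_rowdet.
Qed.

Lemma sum_tree_sign :
  \sum_(T | spanning_tree3 (complete3 'I_N) T) tree_sign T (canonical_orientation N)
  = N%:R ^+ n.-1.
Proof.
have N0 : N%:R != 0 :> int by rewrite NE Num.Theory.pnatr_eq0.
apply: (mulfI N0); rewrite -exprS prednK // -(sum_triple_sets n).
have onesE : prefix_row N N = \sum_q unit_row q.
  by rewrite prefix_rowE; apply: eq_bigl => i; rewrite ltn_ord.
rewrite big_distrr /= [LHS]big_mkcond [RHS]big_mkcond; apply: eq_bigr => T _ /=.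
rewrite -/N onesE rowdet_sum.
case: ifP => [tT|/negbT ntT].
  have q : 'I_N by rewrite NE; exact: ord0.
  have [-> _ _] := tree_sign_rowdet q tT; rewrite eqxx.
  (* Each of the N roots contributes the same sign, which accounts for the factor N. *)
  rewrite (eq_bigr (fun=> tree_sign T (canonical_orientation N))) => [|i _].
    by rewrite sumr_const card_ord mulr_natl.
  by have [_ ->] := tree_sign_rowdet i tT.
by case: eqP => // Tn; rewrite big1 // => q _; apply: not_tree_rowdet.
Qed.

Lemma signed_tree_count :
  (#|positive_trees (canonical_orientation N)|%:R
     - #|negative_trees (canonical_orientation N)|%:R : int) = N%:R ^+ n.-1.
Proof.
rewrite -sum_tree_sign -!sum1_card !natr_sum big_mkcond [X in _ - X]big_mkcond -sumrB.
rewrite [RHS]big_mkcond; apply: eq_bigr => T _; rewrite !inE.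
case: (boolP (spanning_tree3 _ _)) => //= tT; have q : 'I_N by rewrite NE; exact: ord0.
by have [_ _ [[] ->]] := tree_sign_rowdet q tT; rewrite /= ?expr0 ?expr1.
Qed.

End TreeSum.

Local Close Scope ring_scope.

Theorem theorem4p3 (n : nat) (hn : 1 <= n) :
  (#|positive_trees (canonical_orientation (2 * n + 1))|%:Z
     - #|negative_trees (canonical_orientation (2 * n + 1))|%:Z
   = ((2 * n + 1) ^ (n - 1))%N%:Z)%R.
Proof.
by rewrite -!natz signed_tree_count // natrX subn1.
Qed.
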